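(* There exists a sequence $(T_n)_{n\in\mathbb{N}}$ of trees such that for every tree $S$ the limit $\lim_{n\to\infty} d(S,T_n)$ exists and is positive.
   Context: All trees are finite (and have at least one vertex). For a tree $T$, $Z_k(T)$ denotes the number of $k$-vertex subtrees of $T$. An embedding of a tree $S$ in $T$ is a subtree of $T$ isomorphic to $S$ (so embeddings are counted as subgraphs, not as injective homomorphisms). The density $d(S,T)$ of a $k$-vertex tree $S$ in $T$ is the number of embeddings of $S$ in $T$ divided by $Z_k(T)$; if $T$ has fewer than $k$ vertices, $d(S,T)=0$. *)

(* Defs.v *)
From HB Require Import structures.
From mathcomp Require Import all_boot all_order all_algebra.
From mathcomp Require Import all_classical all_reals all_analysis.

Set Implicit Arguments.
Unset Strict Implicit.
Unset Printing Implicit Defensive.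

Import GRing.Theory Num.Theory.
Import numFieldNormedType.Exports.

Local Open Scope ring_scope.

Record sgraph := SGraph {
  vertex :> finType;
  edge : rel vertex;
  edge_sym : symmetric edge;
  edge_irr : irreflexive edge }.

Definition connected_graph (G : sgraph) : Prop :=
  forall x y : G, connect (@edge G) x y.

(* For an edge xy, [:: x; y] is a ucycle of the symmetric relation edge;
   genuine graph cycles are those of size at least 3. *)
Definition acyclic_graph (G : sgraph) : Prop :=
  forall c : seq G, ucycle (@edge G) c -> (size c <= 2)%N.

Definition is_tree (G : sgraph) : Prop :=
  [/\ (0 < #|G|)%N, connected_graph G & acyclic_graph G].

Record tree := Tree { tree_graph :> sgraph; treeP : is_tree tree_graph }.

Definition isomorphic (G H : sgraph) : Prop :=
  exists2 f : G -> H, bijective f &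
    forall x y : G, edge (f x) (f y) = edge x y.

(* A subgraph is a pair (vertex set, edge set), not necessarily induced; an
   undirected edge xy is encoded by the two pairs (x, y) and (y, x), so that
   distinct elements of this type are distinct subgraphs. *)
Definition is_subgraph (G : sgraph) (H : {set G} * {set G * G}) : bool :=
  [forall x, forall y, ((x, y) \in H.2) ==>
    [&& x \in H.1, y \in H.1, edge x y & (y, x) \in H.2]].

Definition subgraph (G : sgraph) : finType :=
  {H : {set G} * {set G * G} | is_subgraph H}.

Section SubgraphGraph.
Variables (G : sgraph) (H : subgraph G).

Definition sub_vertex : finType := {x : G | x \in (sval H).1}.

Definition sub_edge : rel sub_vertex :=
  fun x y => (val x, val y) \in (sval H).2.

Lemma sub_edge_sym : symmetric sub_edge.
Proof.
have sym (x y : G) : (x, y) \in (sval H).2 -> (y, x) \in (sval H).2.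
  by move: (valP H) => /forallP/(_ x)/forallP/(_ y)/implyP h /h /and4P[].
by move=> x y; apply/idP/idP; apply: sym.
Qed.

Lemma sub_edge_irr : irreflexive sub_edge.
Proof.
move=> x; apply/negP => xx.
move: (valP H) => /forallP/(_ (val x))/forallP/(_ (val x))/implyP/(_ xx).
by case/and4P=> _ _; rewrite edge_irr.
Qed.

Definition graph_of_subgraph : sgraph := SGraph sub_edge_sym sub_edge_irr.

End SubgraphGraph.

Definition nb_subtrees (k : nat) (T : sgraph) : nat :=
  #|[set H : subgraph T |
      `[< is_tree (graph_of_subgraph H) /\ #|graph_of_subgraph H| = k >]]|.

Definition nb_embeddings (S T : sgraph) : nat :=
  #|[set H : subgraph T |
      `[< is_tree (graph_of_subgraph H) /\
          isomorphic S (graph_of_subgraph H) >]]|.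

Definition density (R : realType) (S T : tree) : R :=
  if (#|T| < #|S|)%N then 0
  else (nb_embeddings S T)%:R / (nb_subtrees #|S| T)%:R.

(* Main.v *)
(* [T_n] is the binomial tree: [T_0] is a point and [T_(n+1)] arises from [T_n] by
   attaching a pendant leaf to every vertex. It has [2^n] vertices and contains two
   disjoint copies of its predecessor, so the number of copies of any tree, as well as
   the number of [k]-vertex subtrees, at least doubles with [n]; divided by [2^n] these
   numbers are nondecreasing. A connected subgraph of [T_(n+1)] is a single leaf, or
   a connected subgraph of [T_n] together with leaves at some of its vertices, whence
   by induction on [k] the number of [k]-vertex subtrees is [O(2^n)]. Hence both
   normalized counts converge, and every tree [S] occurs in some [T_n]: grow a
   connected vertex set of [S] one vertex at a time, sending each new vertex to
   a pendant leaf. The density is the ratio of the two, with positive limits. *)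
Require Import Defs.
From HB Require Import structures.
From mathcomp Require Import all_boot all_order all_algebra.
From mathcomp Require Import boolp.

Set Implicit Arguments.
Unset Strict Implicit.
Unset Printing Implicit Defensive.

(** * Subgraphs: connectivity and invariance under isomorphism *)

Local Notation V H := (sval H).1.
Local Notation E H := (sval H).2.

Definition sub_rel (G : sgraph) (H : subgraph G) : rel G :=
  [rel x y | (x, y) \in E H].

Lemma subgraphP (G : sgraph) (H : subgraph G) (x y : G) :
  (x, y) \in E H -> [/\ x \in V H, y \in V H, edge x y & (y, x) \in E H].
Proof.
by move=> xy; move: (valP H) => /forallP/(_ x)/forallP/(_ y)/implyP/(_ xy)/and4P.
Qed.

(** Paths are moved from the sigma type of vertices into the ambient graph, where they carry no
    membership proofs. *)
Lemma connected_subgraphP (G : sgraph) (H : subgraph G) :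
  connected_graph (graph_of_subgraph H) <->
  {in V H &, forall x y, connect (sub_rel H) x y}.
Proof.
split=> [conH x y xH yH | conH [x xH] [y yH]].
  have /connectP[p pathp lastp] := conH (Sub x xH) (Sub y yH).
  apply/connectP; exists (map val p); last first.
    by rewrite (last_map val p (Sub x xH)) -lastp.
  exact: homo_path pathp.
have /connectP[p] := conH x y xH yH.
elim: p x xH => [|z p IHp] x xH /=.
  by move=> _ eqyx; apply: eq_connect0; apply: val_inj; rewrite /= eqyx.
case/andP=> xz pathp lastp; have [_ zH _ _] := subgraphP xz.
apply: connect_trans (IHp z zH pathp lastp).
exact: connect1.
Qed.

Lemma isomorphic_sym (G H : sgraph) : isomorphic G H -> isomorphic H G.
Proof.
case=> f [g fK gK] fE; exists g; first by exists f.
by move=> x y; rewrite -fE !gK.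
Qed.

Lemma isomorphic_trans (F G H : sgraph) :
  isomorphic F G -> isomorphic G H -> isomorphic F H.
Proof.
case=> f bij_f fE [g bij_g gE]; exists (g \o f); first exact: bij_comp.
by move=> x y; rewrite /= gE fE.
Qed.

Lemma isomorphic_card (G H : sgraph) : isomorphic G H -> #|G| = #|H|.
Proof. by case=> f /bij_eq_card. Qed.

Lemma isomorphic_tree (G H : sgraph) : isomorphic G H -> is_tree G -> is_tree H.
Proof.
move=> isoGH [G_gt0 conG acyG]; split; first by rewrite -(isomorphic_card isoGH).
  case: isoGH => f [g fK gK] fE x y; rewrite -[x]gK -[y]gK.
  have /connectP[p pathp ->] := conG (g x) (g y).
  apply/connectP; exists (map f p); last by rewrite last_map.
  by apply: homo_path pathp => u v uv; rewrite fE.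
case/isomorphic_sym: isoGH => g bij_g gE c /andP[cyc_c uniq_c].
rewrite -(size_map g); apply: acyG; apply/andP; split.
  by rewrite cycle_map; apply: sub_cycle cyc_c => x y xy /=; rewrite gE.
by rewrite map_inj_uniq //; apply: bij_inj.
Qed.

(** * Images of subgraphs under injective homomorphisms, and doubling of counts *)

Section SubgraphImage.
Variables (G G' : sgraph) (f : G -> G').
Hypotheses (f_inj : injective f) (f_hom : {homo f : x y / edge x y}).

Let f2 (e : G * G) := (f e.1, f e.2).

Let f2_inj : injective f2.
Proof. by move=> [x y] [x' y'] [] /f_inj-> /f_inj->. Qed.

Fact subgraph_image_subproof (H : subgraph G) :
  is_subgraph (f @: V H, f2 @: E H).
Proof.
apply/forallP=> x'; apply/forallP=> y'; apply/implyP=> /imsetP[[x y] xyH [-> ->]].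
have [xH yH xy yxH] := subgraphP xyH; rewrite /= !mem_imset //= f_hom //.
by apply/and4P; split=> //; apply/imsetP; exists (y, x).
Qed.

Definition subgraph_image (H : subgraph G) : subgraph G' :=
  Sub (f @: V H, f2 @: E H) (subgraph_image_subproof H).

Lemma subgraph_image_inj : injective subgraph_image.
Proof.
move=> H K [/(imset_inj f_inj) eqV /(imset_inj f2_inj) eqE].
by apply: val_inj; rewrite [val H]surjective_pairing [val K]surjective_pairing eqV eqE.
Qed.

Lemma isomorphic_subgraph_image (H : subgraph G) :
  isomorphic (graph_of_subgraph H) (graph_of_subgraph (subgraph_image H)).
Proof.
have fV (x : graph_of_subgraph H) : f (val x) \in V (subgraph_image H).
  by rewrite /= mem_imset //; apply: valP.
pose g (x : graph_of_subgraph H) : graph_of_subgraph (subgraph_image H) :=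
  Sub (f (val x)) (fV x).
exists g.
  apply: inj_card_bij => [x y [/f_inj/val_inj] //|].
  by rewrite !card_sig (card_imset _ f_inj).
move=> x y; rewrite /= /sub_edge /=.
exact: (mem_imset (E H) (val x, val y) f2_inj).
Qed.

End SubgraphImage.

(** Common form of [nb_subtrees] and [nb_embeddings], so that doubling is proved once for both. *)
Definition count_subgraphs (P : sgraph -> Prop) (G : sgraph) : nat :=
  #|[set H : subgraph G | `[< P (graph_of_subgraph H) >]]|.

(** Each of [f] and [g] carries the counted subgraphs injectively to counted subgraphs of [G']. As
    the ranges of [f] and [g] are disjoint, a subgraph arising in both ways would have no vertex,
    which the positivity hypothesis on [P] excludes. *)
Lemma count_subgraphs_double (P : sgraph -> Prop) (G G' : sgraph)
    (f g : G -> G') :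
    (forall K K', isomorphic K K' -> P K -> P K') ->
    (forall K, P K -> 0 < #|K|) ->
    injective f -> injective g ->
    {homo f : x y / edge x y} -> {homo g : x y / edge x y} ->
    (forall x y, f x != g y) ->
  2 * count_subgraphs P G <= count_subgraphs P G'.
Proof.
move=> P_iso P_gt0 f_inj g_inj f_hom g_hom dis_fg.
pose F := subgraph_image f_inj f_hom; pose F' := subgraph_image g_inj g_hom.
rewrite /count_subgraphs; set A := [set H : subgraph G | _].
have dis : [disjoint F @: A & F' @: A].
  apply/pred0P=> K /=; apply/negP=> /andP[/imsetP[H1 H1A ->] /imsetP[H2 H2A eqF]].
  have : 0 < #|V H1| by move: H1A; rewrite inE => /asboolP/P_gt0; rewrite card_sig.
  case/card_gt0P=> x xH1; have : f x \in V (F' H2) by rewrite -eqF /= mem_imset.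
  by case/imsetP=> y _ /eqP; rewrite (negPf (dis_fg _ _)).
have -> : 2 * #|A| = #|F @: A :|: F' @: A|.
  rewrite cardsU disjoint_setI0 // cards0 subn0.
  by rewrite !card_imset ?mul2n ?addnn //; apply: subgraph_image_inj.
apply/subset_leq_card/subsetP=> K; rewrite !inE.
by case/orP=> /imsetP[H + ->]; rewrite inE => /asboolP PH; apply/asboolP;
  apply: P_iso PH; apply: isomorphic_subgraph_image.
Qed.

(** * Pendant leaves and binomial trees *)

(** The flag [true] marks the leaf added at a vertex, and [false] the vertex itself. *)
Definition pendant_edge (G : sgraph) : rel (bool * G) := fun p q =>
  if p.1 (+) q.1 then p.2 == q.2 else ~~ p.1 && edge p.2 q.2.

Lemma pendant_edge_sym (G : sgraph) : symmetric (@pendant_edge G).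
Proof.
by move=> [[] x] [[] y]; rewrite /pendant_edge //= 1?eq_sym // edge_sym.
Qed.

Lemma pendant_edge_irr (G : sgraph) : irreflexive (@pendant_edge G).
Proof. by move=> [[] x]; rewrite /pendant_edge //= edge_irr. Qed.

Definition pendant_graph (G : sgraph) : sgraph :=
  SGraph (@pendant_edge_sym G) (@pendant_edge_irr G).

Definition pendant_leaf (G : sgraph) (x : G) : pendant_graph G := (true, x).
Definition pendant_base (G : sgraph) (x : G) : pendant_graph G := (false, x).

Lemma pendant_base_inj (G : sgraph) : injective (@pendant_base G).
Proof. by move=> x y []. Qed.

Lemma pendant_leaf_edge (G : sgraph) (x : G) (p : pendant_graph G) :
  edge (pendant_leaf x) p -> p = pendant_base x.
Proof. by case: p => -[] y // /eqP /= ->. Qed.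

(** A leaf has a single neighbor, so no cycle with three or more vertices passes through it. A cycle
    without leaves lies in the base, where acyclicity of [G] applies. *)
Lemma pendant_tree (G : sgraph) : is_tree G -> is_tree (pendant_graph G).
Proof.
case=> G_gt0 conG acyG; split; first by rewrite card_prod card_bool mul2n double_gt0.
  have sym : connect_sym (@edge (pendant_graph G)) by apply/sym_connect_sym/edge_sym.
  have to_base (p : pendant_graph G) : connect (@edge _) p (pendant_base p.2).
    by case: p => -[] x //=; apply: connect1; rewrite /edge /= /pendant_edge /= eqxx.
  move=> p q; apply: connect_trans (to_base p) _.
  rewrite sym; apply: connect_trans (to_base q) _; rewrite sym.
  have /connectP[s path_s ->] := conG p.2 q.2; apply/connectP.
  by exists (map (@pendant_base G) s); [apply: homo_path path_s | rewrite last_map].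
move=> c /andP[cyc_c uniq_c]; have [/hasP[[b x] x_c /= b_true]|no_leaf] := boolP (has fst c).
  (* Rotated to start at the leaf, a cycle with at least three vertices would have its second and
     its last vertex both equal to the base of that leaf. *)
  rewrite {b}b_true in x_c; have [i c' def_c] := rot_to x_c.
  rewrite -(size_rot i) def_c; move: cyc_c uniq_c.
  rewrite -(rot_cycle i) -(rot_uniq i) def_c.
  case: c' {def_c} => [//|y]; elim/last_ind=> [//|c' z _] /=.
  rewrite rcons_path last_rcons => /and3P[/pendant_leaf_edge-> _].
  rewrite pendant_edge_sym => /pendant_leaf_edge->.
  by rewrite mem_rcons !inE eqxx /= andbF.
have def_c : c = map (@pendant_base G) (map snd c).
  rewrite -map_comp -[LHS]map_id; apply/eq_in_map => -[b x] bx_c /=.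
  by move/hasPn/(_ _ bx_c): no_leaf => /= /negPf->.
rewrite def_c size_map; apply: acyG; apply/andP; split.
  by move: cyc_c; rewrite {1}def_c cycle_map; apply: sub_cycle.
by move: uniq_c; rewrite {1}def_c map_inj_uniq //; apply: pendant_base_inj.
Qed.

Definition point_graph : sgraph :=
  @SGraph unit (fun _ _ => false) (fun _ _ => erefl) (fun _ => erefl).

Lemma point_tree : is_tree point_graph.
Proof.
split; first by rewrite card_unit.
  by move=> [] []; apply: connect0.
by move=> [|[] [|[] c]].
Qed.

Definition binomial_graph (n : nat) : sgraph := iter n pendant_graph point_graph.

Lemma binomial_graph_tree n : is_tree (binomial_graph n).
Proof. by elim: n => [|n IHn]; [apply: point_tree | apply: pendant_tree]. Qed.

Definition binomial_tree n : tree := Tree (binomial_graph_tree n).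

Lemma card_binomial_graph n : #|binomial_graph n| = 2 ^ n.
Proof.
elim: n => [|n IHn]; first by rewrite card_unit.
by rewrite /= card_prod card_bool IHn expnS.
Qed.

(* Attaching pendant leaves is functorial, so the two copies of the point in
   [binomial_graph 1] propagate. *)
Lemma binomial_graph_double n :
  exists f g : binomial_graph n -> binomial_graph n.+1,
    [/\ injective f /\ injective g, {homo f : x y / edge x y},
        {homo g : x y / edge x y} & forall x y, f x != g y].
Proof.
elim: n => [|n [f [g [[f_inj g_inj] f_hom g_hom dis_fg]]]].
  by exists (@pendant_base point_graph), (@pendant_leaf point_graph);
    split=> //; split=> -[] [].
pose lift (h : binomial_graph n -> binomial_graph n.+1)
  (p : binomial_graph n.+1) : binomial_graph n.+2 := (p.1, h p.2).
have lift_inj h : injective h -> injective (lift h).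
  by move=> h_inj [a x] [b y] [-> /h_inj->].
have lift_hom h : {homo h : x y / edge x y} -> {homo lift h : x y / edge x y}.
  move=> h_hom [a x] [b y]; rewrite /edge /= /pendant_edge /=.
  by case: ifP => _; [move/eqP-> | case/andP=> -> /h_hom].
exists (lift f), (lift g); split; first by split; apply: lift_inj.
- exact: lift_hom.
- exact: lift_hom.
by move=> [a x] [b y]; rewrite xpair_eqE (negPf (dis_fg _ _)) andbF.
Qed.

Lemma count_subgraphs_binomial (P : sgraph -> Prop) n :
    (forall K K', isomorphic K K' -> P K -> P K') ->
    (forall K, P K -> 0 < #|K|) ->
  2 * count_subgraphs P (binomial_graph n) <= count_subgraphs P (binomial_graph n.+1).
Proof.
move=> P_iso P_gt0; have [f [g [[f_inj g_inj] f_hom g_hom dis]]] := binomial_graph_double n.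
exact: count_subgraphs_double dis.
Qed.

(** * Embedding an arbitrary tree in a binomial tree *)

Definition induced_rel (G : sgraph) (A : {set G}) : rel G :=
  [rel x y | [&& x \in A, y \in A & edge x y]].

(** Paths have to stay inside [A], so that a vertex outside [A] can close them to cycles. *)
Definition connected_in (G : sgraph) (A : {set G}) : Prop :=
  {in A &, forall x y, connect (induced_rel A) x y}.

(** Otherwise [A] would be closed under adjacency and, by connectedness, contain [b] along with
    [a]. *)
Lemma boundary_edge (G : sgraph) (A : {set G}) (a b : G) :
    connected_graph G -> a \in A -> b \notin A ->
  exists u v, [/\ u \in A, v \notin A & edge u v].
Proof.
move=> conG aA bA.
have [/'exists_'exists_and3P[u [v H]]|] :=
  boolP [exists u, exists v, [&& u \in A, v \notin A & edge u v]]; first by exists u, v.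
move=> /existsPn no_edge; case/negP: bA.
suff A_closed : closed (@edge G) (mem A) by rewrite -(closed_connect A_closed (conG a b)).
apply: intro_closed; first exact/sym_connect_sym/edge_sym.
move=> u v uv uA; have /existsPn/(_ v) := no_edge u.
by rewrite uA uv andbT negbK.
Qed.

(** Two distinct neighbors of [v] in [A] would be joined by a path inside [A], which [v] closes to a
    cycle with at least three vertices. *)
Lemma acyclic_neighbor_unique (G : sgraph) (A : {set G}) (u v w : G) :
    acyclic_graph G -> connected_in A -> u \in A -> w \in A -> v \notin A ->
  edge u v -> edge w v -> u = w.
Proof.
move=> acyG conA uA wA vA uv wv; apply/eqP/negPn/negP => neq_uw.
have /connectP[p0 path_p0 eq_w] := conA u w uA wA.
case/shortenP: path_p0 eq_w => p path_p uniq_p _ eq_w.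
have pA : {subset u :: p <= A}.
  move=> x; rewrite inE => /predU1P[-> //|]; apply/allP: x; move: path_p.
  by elim: p u {uA uv neq_uw uniq_p eq_w} => //= y p IHp x /andP[/and3P[_ -> _] /IHp].
have size_p : 0 < size p by case: (p) eq_w neq_uw => //= ->; rewrite eqxx.
have : size [:: v, u & p] <= 2.
  apply: acyG; rewrite /ucycle cons_uniq uniq_p andbT.
  rewrite (contra (@pA v)) // andbT /= edge_sym uv rcons_path -eq_w wv andbT.
  by apply: sub_path path_p => x y /and3P[].
by rewrite /= !ltnS leqNgt size_p.
Qed.

(* A vertex added to the embedded part goes to the pendant leaf at the image of
   its unique neighbor. *)
Lemma partial_binomial_embedding (S : tree) (k : nat) :
    k < #|S| ->
  exists n (f : S -> binomial_graph n) (A : {set S}),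
    [/\ #|A| = k.+1, connected_in A, {in A &, injective f} &
        {in A &, {homo f : x y / edge x y}}].
Proof.
case: (treeP S) => S_gt0 conS acyS.
elim: k => [_|k IHk ltkS].
  have /card_gt0P[a _] := S_gt0.
  exists 0, (fun _ => tt), [set a]; rewrite cards1; split=> // x y /set1P-> /set1P-> //.
  by rewrite edge_irr.
have [n [f [A [cardA conA f_inj f_hom]]]] := IHk (ltnW ltkS).
have /card_gt0P[a aA] : 0 < #|A| by rewrite cardA.
have /card_gt0P[b] : 0 < #|~: A| by rewrite cardsCs setCK subn_gt0 cardA.
rewrite inE => bA; have [u [v [uA vA uv]]] := boundary_edge conS aA bA.
have unq w : w \in A -> edge w v -> w = u.
  by move=> wA wv; apply: (acyclic_neighbor_unique acyS conA wA uA vA wv uv).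
have vNA w : w \in A -> (w == v) = false.
  by move=> wA; apply: contraNF vA => /eqP<-.
pose g x : binomial_graph n.+1 :=
  if x == v then pendant_leaf (f u) else pendant_base (f x).
exists n.+1, g, (v |: A); split; first by rewrite cardsU1 vA cardA.
(* The enlarged set has to stay connected, since uniqueness of the neighbor of the next added vertex
   relies on it. *)
- have sym : connect_sym (induced_rel (v |: A)).
    apply: sym_connect_sym => x y; rewrite /induced_rel /= edge_sym.
    by rewrite andbCA.
  have conAv x y : x \in A -> y \in A -> connect (induced_rel (v |: A)) x y.
    move=> xA yA; apply: connect_sub (conA x y xA yA) => x' y' /and3P[x'A y'A xy'].
    by apply: connect1; rewrite /induced_rel /= !inE x'A y'A xy' !orbT.
  have conv x : x \in A -> connect (induced_rel (v |: A)) x v.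
    move=> xA; apply: connect_trans (conAv x u xA uA) (connect1 _).
    by rewrite /induced_rel /= !inE eqxx uA uv orbT.
  move=> x y; rewrite !inE => /predU1P[->|xA] /predU1P[->|yA] //.
  + by rewrite sym conv.
  + exact: conv.
  + exact: conAv.
- move=> x y; rewrite !inE /g => /predU1P[->|xA] /predU1P[->|yA] //.
  + by rewrite eqxx vNA.
  + by rewrite eqxx vNA.
  + by rewrite !vNA // => -[]; apply: f_inj.
move=> x y; rewrite !inE /g => /predU1P[->|xA] /predU1P[->|yA].
- by rewrite edge_irr.
- by rewrite eqxx vNA // edge_sym => /(unq _ yA)->; rewrite /edge /= /pendant_edge /= eqxx.
- by rewrite eqxx vNA // => /(unq _ xA)->; rewrite /edge /= /pendant_edge /= eqxx.
- by rewrite !vNA //; apply: f_hom.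
Qed.

Lemma binomial_embedding (S : tree) :
  exists n (f : S -> binomial_graph n),
    injective f /\ {homo f : x y / edge x y}.
Proof.
case: (treeP S) => S_gt0 _ _.
(* With [k] one less than the order of [S], the embedded part is all of [S]. *)
have ltS : #|S|.-1 < #|S| by rewrite prednK.
have [n [f [A [cardA _ f_inj f_hom]]]] := partial_binomial_embedding ltS.
have AT x : x \in A.
  suff -> : A = setT by rewrite inE.
  by apply/eqP; rewrite eqEcard subsetT cardsT cardA prednK //=.
by exists n, f; split=> x y; [apply: f_inj | apply: f_hom].
Qed.

Fact full_subgraph_subproof (G : sgraph) :
  is_subgraph ([set: G], [set e | edge e.1 e.2]).
Proof.
apply/forallP=> x; apply/forallP=> y; apply/implyP.
by rewrite !inE /= => xy; rewrite xy edge_sym xy.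
Qed.

(** Presents [G] as a subgraph of itself, so that [subgraph_image] turns an injective homomorphism
    out of [G] into a copy of [G]. *)
Definition full_subgraph (G : sgraph) : subgraph G :=
  Sub ([set: G], [set e | edge e.1 e.2]) (full_subgraph_subproof G).

Lemma isomorphic_full_subgraph (G : sgraph) :
  isomorphic G (graph_of_subgraph (full_subgraph G)).
Proof.
have inT (x : G) : x \in V (full_subgraph G) by rewrite inE.
exists (fun x => Sub x (inT x) : graph_of_subgraph (full_subgraph G)).
  by exists val => [x|x]; [|apply: val_inj].
by move=> x y; rewrite /= /sub_edge inE.
Qed.

Lemma nb_embeddings_binomial_gt0 (S : tree) :
  exists n, 0 < nb_embeddings S (binomial_graph n).
Proof.
have [n [f [f_inj f_hom]]] := binomial_embedding S; exists n.
apply/card_gt0P; exists (subgraph_image f_inj f_hom (full_subgraph S)).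
have isoS := isomorphic_trans (isomorphic_full_subgraph S)
  (isomorphic_subgraph_image f_inj f_hom (full_subgraph S)).
rewrite inE; apply/asboolP; split=> //.
exact: isomorphic_tree isoS (treeP S).
Qed.

(** * Connected subgraphs of a pendant graph, and a linear bound on their number *)

Fact base_subgraph_subproof (G : sgraph) (H : subgraph (pendant_graph G)) :
  is_subgraph ([set x | pendant_base x \in V H],
               [set e | (pendant_base e.1, pendant_base e.2) \in E H]).
Proof.
apply/forallP=> x; apply/forallP=> y; apply/implyP; rewrite !inE.
by case/(@subgraphP _ H (pendant_base x) (pendant_base y)) => -> -> xy ->; rewrite andbT.
Qed.

Definition base_subgraph (G : sgraph) (H : subgraph (pendant_graph G)) : subgraph G :=
  Sub ([set x | pendant_base x \in V H],
       [set e | (pendant_base e.1, pendant_base e.2) \in E H])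
    (base_subgraph_subproof H).

Definition leaf_set (G : sgraph) (H : subgraph (pendant_graph G)) : {set G} :=
  [set x | pendant_leaf x \in V H].

Section PendantSubgraphs.
Variable G : sgraph.
Implicit Types (H : subgraph (pendant_graph G)) (x y a : G).

(* Collapsing every leaf onto its base retracts [H] onto its base part. *)
Lemma base_subgraph_connected H :
  connected_graph (graph_of_subgraph H) ->
  connected_graph (graph_of_subgraph (base_subgraph H)).
Proof.
move/connected_subgraphP=> conH; apply/connected_subgraphP=> x y.
rewrite !inE => xH yH; have /connectP[p] := conH _ _ xH yH.
suff retract (u : pendant_graph G) : path (sub_rel H) u p ->
    connect (sub_rel (base_subgraph H)) u.2 (last u p).2.
  by move=> /retract /[swap] <-.
elim: p u => [|v p IHp] u /=; first by rewrite connect0.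
case/andP=> uv /IHp; apply: connect_trans; have [_ _ + _] := subgraphP uv.
case: u v uv => [[] u] [[] v] uv //=; rewrite /edge /= /pendant_edge /=.
- by move/eqP->; apply: connect0.
- by move/eqP->; apply: connect0.
by move=> _; apply: connect1; rewrite /sub_rel /= inE.
Qed.

(** The path in [H] from the leaf to the base vertex [a] has to leave the leaf along its only
    edge. *)
Lemma leaf_base_edge H x a :
    connected_graph (graph_of_subgraph H) -> pendant_base a \in V H ->
  pendant_leaf x \in V H -> (pendant_leaf x, pendant_base x) \in E H.
Proof.
move/connected_subgraphP=> conH aH xH; have /connectP[[|u p] //=] := conH _ _ xH aH.
case/andP=> xu _ _; have [_ _ /pendant_leaf_edge eq_u _] := subgraphP xu.
by rewrite -eq_u.
Qed.

Lemma leaf_base_edgeE H x y a :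
    connected_graph (graph_of_subgraph H) -> pendant_base a \in V H ->
  ((pendant_leaf x, pendant_base y) \in E H) = (x \in leaf_set H) && (y == x).
Proof.
move=> conH aH; rewrite inE; apply/idP/andP=> [xy | [xH /eqP->]].
  have [xH _ /pendant_leaf_edge[->] _] := subgraphP xy.
  by rewrite xH eqxx.
exact: leaf_base_edge aH xH.
Qed.

(** Two leaves are never adjacent, and the edges between leaves and base are forced by
    [leaf_base_edgeE]; the base part records the rest. This makes the encoding used for counting
    injective. *)
Lemma pendant_subgraph_inj H H' a a' :
    connected_graph (graph_of_subgraph H) -> pendant_base a \in V H ->
    connected_graph (graph_of_subgraph H') -> pendant_base a' \in V H' ->
  base_subgraph H = base_subgraph H' -> leaf_set H = leaf_set H' -> H = H'.
Proof.
move=> conH aH conH' aH' eq_base eq_leaf.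
have symE (K : subgraph (pendant_graph G)) (p q : pendant_graph G) :
    ((p, q) \in E K) = ((q, p) \in E K).
  by apply/idP/idP=> /subgraphP[].
have leafE (K : subgraph (pendant_graph G)) (x y : G) :
    ((pendant_leaf x, pendant_leaf y) \in E K) = false.
  by apply/negP=> /subgraphP[_ _ /pendant_leaf_edge].
apply: val_inj; rewrite [val H]surjective_pairing [val H']surjective_pairing.
congr pair; apply/setP.
  case=> -[] x; first by move/setP/(_ x): eq_leaf; rewrite !inE.
  by move/(congr1 (fun K : subgraph G => x \in V K)): eq_base; rewrite !inE.
case=> -[[] x] [[] y].
- by rewrite !leafE.
- by rewrite (leaf_base_edgeE _ _ conH aH) (leaf_base_edgeE _ _ conH' aH') eq_leaf.
- by rewrite !(symE _ (false, x)) (leaf_base_edgeE _ _ conH aH)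
    (leaf_base_edgeE _ _ conH' aH') eq_leaf.
by move/(congr1 (fun K : subgraph G => (x, y) \in E K)): eq_base; rewrite !inE.
Qed.

(** The exceptional case of a subgraph that misses the base: the only neighbor of each leaf is
    absent, so there are no edges, and connectedness leaves one vertex. *)
Lemma leaf_subgraph H x :
    connected_graph (graph_of_subgraph H) -> pendant_leaf x \in V H ->
    (forall a, pendant_base a \notin V H) ->
  val H = ([set pendant_leaf x], set0).
Proof.
move=> conH xH noH; rewrite [val H]surjective_pairing.
have E0 p q : (p, q) \notin E H.
  apply/negP=> /subgraphP[]; case: p => -[] x'; last by rewrite (negPf (noH x')).
  by move=> _ + /pendant_leaf_edge eq_q; rewrite eq_q (negPf (noH x')).
congr pair; apply/setP; last by case=> p q; rewrite (negPf (E0 p q)) inE.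
move=> p; rewrite inE; apply/idP/eqP=> [pH | -> //].
move/connected_subgraphP: conH => /(_ _ _ xH pH)/connectP[[|q s] //=].
by case/andP=> /(negP (E0 _ _)).
Qed.

End PendantSubgraphs.

Definition connected_subgraphs (k : nat) (G : sgraph) : {set subgraph G} :=
  [set H : subgraph G |
     `[< connected_graph (graph_of_subgraph H) >] && (0 < #|V H| <= k)].

(** The three terms account for single leaves, for subgraphs inside the base, and for base parts
    with leaves attached. In the last case the base part has at most [k] vertices, so the leaves sit
    over one of at most [2 ^ k] subsets of it. *)
Lemma card_connected_subgraphs_pendant (k : nat) (G : sgraph) :
  #|connected_subgraphs k.+1 (pendant_graph G)| <=
    #|G| + #|connected_subgraphs k.+1 G| + 2 ^ k * #|connected_subgraphs k G|.
Proof.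
(* [B] collects the subgraphs that meet the base; among the counted ones, only single leaves lie
   outside it. *)
pose B : {set subgraph (pendant_graph G)} :=
  [set H : subgraph (pendant_graph G) | [exists a, pendant_base a \in V H]].
rewrite -(cardsID B) addnC -addnA; apply: leq_add.
  rewrite -(card_imset _ val_inj).
  pose single (x : G) :=
    ([set pendant_leaf x], @set0 (pendant_graph G * pendant_graph G)%type).
  apply: leq_trans (leq_imset_card single G).
  apply/subset_leq_card/subsetP=> _ /imsetP[H + ->].
  rewrite !inE => /andP[/existsPn noH /andP[/asboolP conH /andP[+ _]]].
  case/card_gt0P=> -[[] x] xH; last by case/negP: (noH x).
  by rewrite (leaf_subgraph conH xH noH); apply: imset_f.
(* Targets of the encoding by base part and leaf positions: [D1] receives the subgraphs without
   leaves, [D2] those with some. *)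
pose D1 := setX (connected_subgraphs k.+1 G) [set @set0 G].
pose D2 := [set p : subgraph G * {set G} |
  (p.1 \in connected_subgraphs k G) && (p.2 \subset V p.1)].
have cardD2 : #|D2| <= 2 ^ k * #|connected_subgraphs k G|.
  rewrite mulnC -sum_nat_const -sum1_card.
  rewrite (eq_bigl (fun p : subgraph G * {set G} =>
    (p.1 \in connected_subgraphs k G) && (p.2 \subset V p.1))); last by move=> p; rewrite inE.
  rewrite -(pair_big_dep (fun K => K \in connected_subgraphs k G)
    (fun K (A : {set G}) => A \subset V K) (fun _ _ => 1)) /=.
  apply: leq_sum => K; rewrite inE => /and3P[_ _ leKk].
  by rewrite sum1dep_card -/(powerset _) card_powerset leq_exp2l.
apply: leq_trans (leq_add (leqnn _) cardD2).
have -> : #|connected_subgraphs k.+1 G| = #|D1| by rewrite cardsX cards1 muln1.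
apply: leq_trans (leq_card_setU D1 D2).
pose code (H : subgraph (pendant_graph G)) := (base_subgraph H, leaf_set H).
rewrite -(card_in_imset (f := code)); last first.
  move=> H H'; rewrite !inE.
  case/andP=> /andP[/asboolP conH _] /existsP[a aH].
  case/andP=> /andP[/asboolP conH' _] /existsP[a' aH'] eq_code.
  exact: (pendant_subgraph_inj conH aH conH' aH' (congr1 fst eq_code) (congr1 snd eq_code)).
apply/subset_leq_card/subsetP=> _ /imsetP[H + ->].
rewrite !inE => /andP[/andP[/asboolP conH /andP[_ leHk]] /existsP[a aH]] /=.
have conB : `[< connected_graph (graph_of_subgraph (base_subgraph H)) >].
  exact/asboolP/base_subgraph_connected.
have B_gt0 : 0 < #|V (base_subgraph H)| by apply/card_gt0P; exists a; rewrite inE.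
rewrite conB B_gt0 /=; set U := [set x | _].
have subU : @pendant_base G @: U \subset V H.
  by apply/subsetP=> _ /imsetP[x + ->]; rewrite inE.
have cardU : #|@pendant_base G @: U| = #|U| by rewrite card_imset //; apply: pendant_base_inj.
(* A leaf in [H] makes the base part a proper subset of the vertices, which lowers the size bound
   from [k.+1] to [k]. *)
have [->|[x xS]] := set_0Vmem (leaf_set H).
  by rewrite -cardU (leq_trans (subset_leq_card subU) leHk) eqxx.
apply/orP; right; apply/andP; split.
  rewrite -ltnS -cardU; apply: leq_trans leHk; apply: proper_card.
  apply/properP; split=> //; exists (pendant_leaf x); first by move: xS; rewrite inE.
  by apply/negP=> /imsetP[].
apply/subsetP=> y; rewrite !inE => yH.
by have [] := subgraphP (leaf_base_edge conH aH yH).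
Qed.

Lemma card_connected_subgraphs_binomial (k : nat) :
  exists b, forall n, #|connected_subgraphs k (binomial_graph n)| <= b * 2 ^ n.
Proof.
elim: k => [|k [b leb]].
  exists 0 => n; rewrite mul0n leqn0 cards_eq0; apply/eqP/setP=> H.
  by rewrite !inE lt0n leqn0 andNb andbF.
(* The summands [1 + 2 ^ k * b] pay for the passage from [n] to [n.+1], the last one for [n = 0]. *)
pose b' := 1 + 2 ^ k * b + #|{: subgraph point_graph}|.
exists b'; elim=> [|n IHn]; first by rewrite muln1 (leq_trans (max_card _)) ?leq_addl.
apply: leq_trans (card_connected_subgraphs_pendant k (binomial_graph n)) _.
(* The new bound is twice [b' * 2 ^ n]: one copy absorbs the induction hypothesis on [n], the other
   the two remaining terms. *)
rewrite card_binomial_graph expnS mulnCA mul2n -addnn.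
rewrite addnAC addnC; apply: leq_add IHn _.
rewrite /b' mulnDl mulnDl mul1n -mulnA; apply: leq_trans (leq_addr _ _).
by rewrite leq_add2l leq_mul2l leb orbT.
Qed.

(** * Bounds and doubling for subtrees and embeddings *)

Lemma nb_subtrees_binomial (k : nat) :
  exists b, forall n, nb_subtrees k (binomial_graph n) <= b * 2 ^ n.
Proof.
have [b leb] := card_connected_subgraphs_binomial k; exists b => n.
apply: leq_trans (leb n); apply/subset_leq_card/subsetP=> H.
rewrite !inE => /asboolP[[H_gt0 conH _] cardH].
move: H_gt0 cardH; rewrite card_sig => H_gt0 cardH.
by apply/andP; split; [apply/asboolP | rewrite H_gt0 -cardH leqnn].
Qed.

Lemma nb_embeddings_le (S : tree) (G : sgraph) :
  nb_embeddings S G <= nb_subtrees #|S| G.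
Proof.
apply/subset_leq_card/subsetP=> H; rewrite !inE => /asboolP[treeH isoH].
by apply/asboolP; split=> //; rewrite (isomorphic_card isoH).
Qed.

Lemma nb_subtrees_double (k n : nat) :
  2 * nb_subtrees k (binomial_graph n) <= nb_subtrees k (binomial_graph n.+1).
Proof.
apply: (count_subgraphs_binomial (P := fun K => is_tree K /\ #|K| = k)).
  move=> K K' isoK [treeK <-]; rewrite (isomorphic_card isoK).
  by split=> //; apply: isomorphic_tree treeK.
by move=> K [[]].
Qed.

Lemma nb_embeddings_double (S : tree) (n : nat) :
  2 * nb_embeddings S (binomial_graph n) <= nb_embeddings S (binomial_graph n.+1).
Proof.
apply: (count_subgraphs_binomial (P := fun K => is_tree K /\ isomorphic S K)).
  move=> K K' isoK [treeK isoSK]; split; first exact: isomorphic_tree treeK.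
  exact: isomorphic_trans isoK.
by move=> K [[]].
Qed.

(* Convergence of the normalized counts and of the density *)
From mathcomp Require Import all_classical all_reals all_analysis.

Import Order.TTheory GRing.Theory Num.Theory.
Import numFieldNormedType.Exports.

Local Open Scope classical_set_scope.
Local Open Scope ring_scope.

(** Doubling makes the normalized sequence nondecreasing, and the bound makes it converge. Since
    every term lies below the limit, a single positive term later yields a positive limit. *)
Lemma doubling_cvg (R : realType) (c : nat -> nat) (b : nat) :
    (forall n, 2 * c n <= c n.+1)%N -> (forall n, c n <= b * 2 ^ n)%N ->
  exists2 l : R, (c n)%:R / 2 ^+ n @[n --> \oo] --> l &
    forall n, (c n)%:R / 2 ^+ n <= l.
Proof.
move=> dbl bnd; pose u n : R := (c n)%:R / 2 ^+ n.
have u_nd : nondecreasing_seq u.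
  apply/nondecreasing_seqP => n; rewrite /u ler_pdivrMr ?exprn_gt0 //.
  rewrite exprS invfM mulrA mulfVK ?expf_neq0 // ler_pdivlMr //.
  by rewrite -natrM ler_nat mulnC.
have u_bnd : has_ubound (range u).
  exists b%:R => _ [n _ <-]; rewrite ler_pdivrMr ?exprn_gt0 //.
  by rewrite -natrX -natrM ler_nat.
have u_cvg := nondecreasing_is_cvgn u_nd u_bnd.
by exists (limn u) => // n; apply: nondecreasing_cvgn_le.
Qed.

Theorem theorem14 (R : realType) :
  exists T : nat -> tree, forall S : tree,
    exists l : R, density R S (T n) @[n --> \oo] --> l /\ 0 < l.
Proof.
exists binomial_tree => S; have [b leb] := nb_subtrees_binomial #|S|.
have [l u_l le_l] := doubling_cvg R (nb_embeddings_double S)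
  (fun n => leq_trans (nb_embeddings_le S (binomial_graph n)) (leb n)).
have [l' z_l' le_l'] := doubling_cvg R (nb_subtrees_double #|S|) leb.
have [m m_gt0] := nb_embeddings_binomial_gt0 S.
have l_gt0 : 0 < l.
  by apply: lt_le_trans (le_l m); rewrite divr_gt0 ?ltr0n ?exprn_gt0.
have l'_gt0 : 0 < l'.
  apply: lt_le_trans (le_l' m); rewrite divr_gt0 ?exprn_gt0 // ltr0n.
  exact: leq_trans (nb_embeddings_le S _).
exists (l / l'); split; last exact: divr_gt0.
(* The powers of two cancel in the quotient of the normalized counts, which therefore agrees with
   the density for large [n]. *)
apply: cvg_trans (cvgM u_l (cvgV (lt0r_neq0 l'_gt0) z_l')).
apply: near_eq_cvg; near=> n.
rewrite /density ifF /=.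
  by rewrite /= invfM invrK mulrACA mulVf ?mulr1 ?expf_neq0.
(* The default value 0 of the density is avoided once [n] is at least the order of [S], as
   [n <= 2 ^ n]. *)
rewrite card_binomial_graph ltnNge; apply/negbTE; rewrite negbK.
apply: leq_trans (ltnW (ltn_expl n (leqnn 2))).
by near: n; apply: nbhs_infty_ge.
Unshelve. all: by end_near.
Qed.
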